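(* Let $\mathcal{C}$ be a $0$-abelian category with enough injectives. Every bimorphism $f\in\mathcal{C}(X,Y)$ in $\mathcal{C}$ induces an exact sequence $$0\to \mathcal{C}(-,X)\xrightarrow{\ \mathcal{C}(-,f)\ }\mathcal{C}(-,Y)\to \mathrm{E}_{\mathcal{C}}(-,X)\xrightarrow{\ \mathrm{E}_{\mathcal{C}}(-,f)\ }\mathrm{E}_{\mathcal{C}}(-,Y)\to 0$$ in $\mathrm{mod}\,\mathcal{C}$; that is, there is a morphism $\mathcal{C}(-,Y)\to \mathrm{E}_{\mathcal{C}}(-,X)$ in $\mathrm{mod}\,\mathcal{C}$ making this sequence exact.
   Context: For an additive category $\mathcal{C}$, $\mathrm{mod}\,\mathcal{C}$ is the category of finitely presented additive functors $\mathcal{C}^{\mathrm{op}}\to\mathrm{Ab}$ (cokernels of morphisms $\mathcal{C}(-,X)\to\mathcal{C}(-,Y)$), and $\mathrm{mod}\,\mathcal{C}^{\mathrm{op}}$ is the category of finitely presented additive functors $\mathcal{C}\to\mathrm{Ab}$. $\mathcal{C}$ is right (left) coherent if $\mathrm{mod}\,\mathcal{C}$ ($\mathrm{mod}\,\mathcal{C}^{\mathrm{op}}$) is abelian. $\mathcal{C}$ is $0$-abelian if it is additive, idempotent complete, right and left coherent, and both $\mathrm{mod}\,\mathcal{C}$ and $\mathrm{mod}\,\mathcal{C}^{\mathrm{op}}$ have global dimension at most $1$. Equivalently, $\mathcal{C}$ is additive and every morphism decomposes both as a split epimorphism followed by a monomorphism and as an epimorphism followed by a split monomorphism. A bimorphism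 is a morphism that is both a monomorphism and an epimorphism. An object $I$ is injective if every morphism $X\to I$ extends along every monomorphism $X\to Y$; $\mathcal{C}$ has enough injectives if every object admits a monomorphism into an injective object. Definition of $\mathrm{E}_{\mathcal{C}}$. Let $\mathcal{C}$ be $0$-abelian with enough injectives. For each $X\in\mathcal{C}$ there is a bimorphism $\eta_X:X\to X_{\mathcal{I}}$ with $X_{\mathcal{I}}$ injective (unique up to unique isomorphism; choices are fixed), and for each $f\in\mathcal{C}(X,Y)$ there is a unique $f_{\mathcal{I}}:X_{\mathcal{I}}\to Y_{\mathcal{I}}$ with $f_{\mathcal{I}}\eta_X=\eta_Y f$. For each $X$ choose a cokernel $\psi_{-,X}:\mathcal{C}(-,X_{\mathcal{I}})\to \mathrm{E}_{\mathcal{C}}(-,X)$ of $\mathcal{C}(-,\eta_X)$ in $\mathrm{mod}\,\mathcal{C}$, and for $f\in\mathcal{C}(X,Y)$ let $\mathrm{E}_{\mathcal{C}}(-,f):\mathrm{E}_{\mathcal{C}}(-,X)\to\mathrm{E}_{\mathcal{C}}(-,Y)$ be the unique morphism with $\mathrm{E}_{\mathcal{C}}(-,f)\,\psi_{-,X}=\psi_{-,Y}\,\mathcal{C}(-,f_{\mathcal{I}})$. This defines an additive functor $\mathcal{C}\to\mathrm{mod}\,\mathcal{C}$, hence a biadditive bifunctor $\mathrm{E}_{\mathcal{C}}(-,-):\mathcal{C}^{\mathrm{op}}\times\mathcal{C}\to\mathrm{Ab}$. *)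

(* Defs.v *)
From HB Require Import structures.
From mathcomp Require Import all_boot all_algebra.
From mathcomp Require Import boolp.

Set Implicit Arguments.
Unset Strict Implicit.
Unset Printing Implicit Defensive.

Import GRing.Theory.
Local Open Scope ring_scope.
Local Obligation Tactic := idtac.

(* The type of objects is a parameter and not a field: this keeps the universe
   of the objects of C (below that of zmodType) apart from the one of the
   objects of mod C (above it). *)
Record preadditive (obj : Type) := Preadditive {
  mor : obj -> obj -> zmodType;
  idm : forall X, mor X X;
  mcomp : forall X Y Z, mor Y Z -> mor X Y -> mor X Z;
  compA : forall X Y Z W (h : mor Z W) (g : mor Y Z) (f : mor X Y),
    mcomp h (mcomp g f) = mcomp (mcomp h g) f;
  comp1m : forall X Y (f : mor X Y), mcomp (idm Y) f = f;
  compm1 : forall X Y (f : mor X Y), mcomp f (idm X) = f;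
  compDl : forall X Y Z (g g' : mor Y Z) (f : mor X Y),
    mcomp (g + g') f = mcomp g f + mcomp g' f;
  compDr : forall X Y Z (g : mor Y Z) (f f' : mor X Y),
    mcomp g (f + f') = mcomp g f + mcomp g f' }.

Arguments idm {obj C} X : rename.
Arguments mcomp {obj C X Y Z} g f : rename.

Notation "g \oc f" := (mcomp g f) (at level 40, left associativity).

Section CategoricalNotions.
Context {obj : Type} (C : preadditive obj).

Definition is_mono X Y (f : mor C X Y) :=
  forall T (u v : mor C T X), f \oc u = f \oc v -> u = v.

Definition is_epi X Y (f : mor C X Y) :=
  forall T (u v : mor C Y T), u \oc f = v \oc f -> u = v.

Definition bimorphism X Y (f : mor C X Y) := is_mono f /\ is_epi f.

Definition is_kernel X Y (f : mor C X Y) K (k : mor C K X) :=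
  f \oc k = 0 /\
  forall T (t : mor C T X), f \oc t = 0 -> exists! u : mor C T K, k \oc u = t.

Definition is_cokernel X Y (f : mor C X Y) Q (q : mor C Y Q) :=
  q \oc f = 0 /\
  forall T (t : mor C Y T), t \oc f = 0 -> exists! u : mor C Q T, u \oc q = t.

Definition is_zero_obj (Z : obj) :=
  (forall X, exists! f : mor C Z X, True) /\
  (forall X, exists! f : mor C X Z, True).

Definition is_biproduct X Y P (i1 : mor C X P) (i2 : mor C Y P)
    (p1 : mor C P X) (p2 : mor C P Y) :=
  [/\ p1 \oc i1 = idm X, p2 \oc i2 = idm Y, p1 \oc i2 = 0, p2 \oc i1 = 0
    & i1 \oc p1 + i2 \oc p2 = idm P].

Definition is_additive :=
  (exists Z, is_zero_obj Z) /\
  (forall X Y, exists P (i1 : mor C X P) (i2 : mor C Y P)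
     (p1 : mor C P X) (p2 : mor C P Y), is_biproduct i1 i2 p1 p2).

Definition idempotent_complete :=
  forall X (e : mor C X X), e \oc e = e ->
  exists Y (r : mor C X Y) (s : mor C Y X), r \oc s = idm Y /\ s \oc r = e.

Definition is_abelian :=
  [/\ is_additive,
      forall X Y (f : mor C X Y), exists K (k : mor C K X), is_kernel f k,
      forall X Y (f : mor C X Y), exists Q (q : mor C Y Q), is_cokernel f q,
      forall X Y (f : mor C X Y), is_mono f ->
        exists Z (g : mor C Y Z), is_kernel g f
    & forall X Y (f : mor C X Y), is_epi f ->
        exists Z (g : mor C Z X), is_cokernel g f].

(* Im f = Ker g, where the image of f is the kernel of its cokernel. *)
Definition exact X Y Z (f : mor C X Y) (g : mor C Y Z) :=
  exists Q (q : mor C Y Q) I (m : mor C I Y),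
    [/\ is_cokernel f q, is_kernel q m & is_kernel g m].

(* Exactness of 0 -> X -> Y at X. *)
Definition exact0l X Y (f : mor C X Y) :=
  exists Z, is_zero_obj Z /\ exact (0 : mor C Z X) f.

(* Exactness of X -> Y -> 0 at Y. *)
Definition exact0r X Y (f : mor C X Y) :=
  exists Z, is_zero_obj Z /\ exact f (0 : mor C Y Z).

(* 0 -> X1 -> X2 -> X3 -> X4 -> 0 *)
Definition exact_seq4 X1 X2 X3 X4
    (f : mor C X1 X2) (g : mor C X2 X3) (h : mor C X3 X4) :=
  [/\ exact0l f, exact f g, exact g h & exact0r h].

Definition is_injective (I : obj) :=
  forall X Y (m : mor C X Y) (f : mor C X I), is_mono m ->
  exists g : mor C Y I, g \oc m = f.

Definition is_projective (P : obj) :=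
  forall X Y (e : mor C X Y) (f : mor C P Y), is_epi e ->
  exists g : mor C P X, e \oc g = f.

Definition enough_injectives :=
  forall X, exists I (m : mor C X I), is_injective I /\ is_mono m.

Definition proj_dim_le (n : nat) (M : obj) :=
  exists (P : nat -> obj) (d : forall i, mor C (P i.+1) (P i))
         (a : mor C (P 0) M),
    [/\ forall i, is_projective (P i),
        forall i, (n < i)%N -> is_zero_obj (P i),
        forall i, exact (d i.+1) (d i),
        exact (d 0) a
      & exact0r a].

(* Global dimension in terms of projective resolutions; this is only used for
   mod C, which has enough projectives (the representable functors). *)
Definition gl_dim_le (n : nat) := forall M, proj_dim_le n M.

End CategoricalNotions.

Definition opcat (obj : Type) (C : preadditive obj) : preadditive obj :=
  @Preadditive obj (fun X Y => mor C Y X) (fun X => idm X)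
    (fun _ _ _ g f => f \oc g)
    (fun _ _ _ _ h g f => esym (compA f g h))
    (fun _ _ f => compm1 f) (fun _ _ f => comp1m f)
    (fun _ _ _ g g' f => compDr f g g')
    (fun _ _ _ g f f' => compDl f f' g).

Definition full_subcat (obj : Type) (C : preadditive obj) (P : obj -> Prop) :
    preadditive {X : obj | P X} :=
  @Preadditive {X : obj | P X} (fun X Y => mor C (sval X) (sval Y))
    (fun X => idm (sval X)) (fun _ _ _ g f => g \oc f)
    (fun _ _ _ _ h g f => compA h g f)
    (fun _ _ f => comp1m f) (fun _ _ f => compm1 f)
    (fun _ _ _ g g' f => compDl g g' f)
    (fun _ _ _ g f f' => compDr g f f').

(* Additive functors C^op -> Ab. *)
Record presheaf (obj : Type) (C : preadditive obj) := Presheaf {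
  psh_obj : obj -> zmodType;
  psh_map : forall X Y, mor C X Y -> psh_obj Y -> psh_obj X;
  psh_mapD : forall X Y (f : mor C X Y), {morph psh_map f : x y / x + y};
  psh_map1 : forall X x, psh_map (idm X) x = x;
  psh_mapM : forall X Y Z (g : mor C Y Z) (f : mor C X Y) x,
    psh_map (g \oc f) x = psh_map f (psh_map g x);
  psh_map_add : forall X Y (f g : mor C X Y) x,
    psh_map (f + g) x = psh_map f x + psh_map g x }.

Arguments psh_map {obj C} F {X Y} f x : rename.

Record nattrans (obj : Type) (C : preadditive obj) (F G : presheaf C) :=
  Nattrans {
    nat_app :> forall X, psh_obj F X -> psh_obj G X;
    nat_appD : forall X, {morph @nat_app X : x y / x + y};
    nat_nat : forall X Y (f : mor C X Y) x,
      nat_app (psh_map F f x) = psh_map G f (nat_app x) }.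

Arguments nat_app {obj C F G} a X x : rename.

Section FunctorCategory.
Context {obj : Type} {C : preadditive obj}.

Lemma nattrans_ext (F G : presheaf C) (a b : nattrans F G) :
  (forall X x, a X x = b X x) -> a = b.
Proof.
case: a b => [a aD aN] [b bD bN] /= ab.
have E : a = b by apply: functional_extensionality_dep => X; apply: funext.
by rewrite -{b ab}E in bD bN *; congr Nattrans; apply: Prop_irrelevance.
Qed.

Section NattransZmod.
Variables F G : presheaf C.
Implicit Types a b : nattrans F G.

Lemma psh_map0 (H : presheaf C) X Y (f : mor C X Y) : psh_map H f 0 = 0.
Proof. by apply: (addrI (psh_map H f 0)); rewrite -psh_mapD !addr0. Qed.

Lemma psh_mapN (H : presheaf C) X Y (f : mor C X Y) x :
  psh_map H f (- x) = - psh_map H f x.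
Proof. by apply: (addrI (psh_map H f x)); rewrite -psh_mapD !subrr psh_map0. Qed.

Program Definition nat_zero := @Nattrans obj C F G (fun _ _ => 0) _ _.
Next Obligation. by move=> X x y /=; rewrite addr0. Qed.
Next Obligation. by move=> X Y f x /=; rewrite psh_map0. Qed.

Program Definition nat_opp a := @Nattrans obj C F G (fun X x => - a X x) _ _.
Next Obligation. by move=> a X x y /=; rewrite nat_appD opprD. Qed.
Next Obligation. by move=> a X Y f x /=; rewrite nat_nat psh_mapN. Qed.

Program Definition nat_add a b :=
  @Nattrans obj C F G (fun X x => a X x + b X x) _ _.
Next Obligation. by move=> a b X x y /=; rewrite !nat_appD addrACA. Qed.
Next Obligation. by move=> a b X Y f x /=; rewrite !nat_nat psh_mapD. Qed.

HB.instance Definition _ := gen_eqMixin (nattrans F G).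
HB.instance Definition _ := gen_choiceMixin (nattrans F G).

Fact nat_addA : associative nat_add.
Proof. by move=> a b c; apply: nattrans_ext => X x /=; rewrite addrA. Qed.
Fact nat_addC : commutative nat_add.
Proof. by move=> a b; apply: nattrans_ext => X x /=; rewrite addrC. Qed.
Fact nat_add0 : left_id nat_zero nat_add.
Proof. by move=> a; apply: nattrans_ext => X x /=; rewrite add0r. Qed.
Fact nat_addN : left_inverse nat_zero nat_opp nat_add.
Proof. by move=> a; apply: nattrans_ext => X x /=; rewrite addNr. Qed.

HB.instance Definition _ := GRing.isZmodule.Build (nattrans F G)
  nat_addA nat_addC nat_add0 nat_addN.

End NattransZmod.

Program Definition nat_id (F : presheaf C) := @Nattrans obj C F F (fun _ x => x) _ _.
Next Obligation. by []. Qed.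
Next Obligation. by []. Qed.

Program Definition nat_comp (F G H : presheaf C)
    (b : nattrans G H) (a : nattrans F G) :=
  @Nattrans obj C F H (fun X x => b X (a X x)) _ _.
Next Obligation. by move=> F G H b a X x y /=; rewrite !nat_appD. Qed.
Next Obligation. by move=> F G H b a X Y f x /=; rewrite !nat_nat. Qed.

End FunctorCategory.

(* The category of all additive functors C^op -> Ab. *)
Program Definition Psh (obj : Type) (C : preadditive obj) :
    preadditive (presheaf C) :=
  @Preadditive (presheaf C) (fun F G => nattrans F G) (@nat_id obj C)
    (@nat_comp obj C) _ _ _ _ _.
Next Obligation. by move=> *; apply: nattrans_ext. Qed.
Next Obligation. by move=> *; apply: nattrans_ext. Qed.
Next Obligation. by move=> *; apply: nattrans_ext. Qed.
Next Obligation. by move=> *; apply: nattrans_ext. Qed.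
Next Obligation. by move=> *; apply: nattrans_ext => X x /=; rewrite nat_appD. Qed.

Section Representables.
Context {obj : Type} (C : preadditive obj).

Program Definition yoneda (X : obj) : presheaf C :=
  @Presheaf obj C (fun T => mor C T X) (fun _ _ f x => x \oc f) _ _ _ _.
Next Obligation. by move=> X T S f x y /=; rewrite compDl. Qed.
Next Obligation. by move=> X T x /=; rewrite compm1. Qed.
Next Obligation. by move=> X T S R g f x /=; rewrite compA. Qed.
Next Obligation. by move=> X T S f g x /=; rewrite compDr. Qed.

Program Definition yoneda_map (X Y : obj) (f : mor C X Y) :
    nattrans (yoneda X) (yoneda Y) :=
  @Nattrans obj C (yoneda X) (yoneda Y) (fun T x => f \oc x) _ _.
Next Obligation. by move=> X Y f T x y /=; rewrite compDr. Qed.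
Next Obligation. by move=> X Y f T S g x /=; rewrite compA. Qed.

Definition finitely_presented (F : presheaf C) :=
  exists X Y (a : mor (Psh C) (yoneda X) (yoneda Y))
         (p : mor (Psh C) (yoneda Y) F), is_cokernel a p.

Lemma yoneda_fp (X : obj) : finitely_presented (yoneda X).
Proof.
exists X, X, 0, (idm (yoneda X)); split; first by rewrite comp1m.
move=> T t _; exists t; split; first by rewrite compm1.
by move=> u <-; rewrite compm1.
Qed.

Definition mod_obj := {F : presheaf C | finitely_presented F}.

Definition mod_cat : preadditive mod_obj :=
  full_subcat (Psh C) finitely_presented.

Definition mod_yo (X : obj) : mod_obj :=
  exist finitely_presented (yoneda X) (yoneda_fp X).

Definition mod_yo_map (X Y : obj) (f : mor C X Y) :
    mor mod_cat (mod_yo X) (mod_yo Y) := yoneda_map f.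

End Representables.

Definition right_coherent (obj : Type) (C : preadditive obj) :=
  is_abelian (mod_cat C).

Definition left_coherent (obj : Type) (C : preadditive obj) :=
  is_abelian (mod_cat (opcat C)).

Definition zero_abelian (obj : Type) (C : preadditive obj) :=
  [/\ is_additive C,
      idempotent_complete C,
      right_coherent C /\ left_coherent C,
      gl_dim_le (mod_cat C) 1
    & gl_dim_le (mod_cat (opcat C)) 1].

(* The choices that define the functor E_C : C -> mod C. The morphisms f_I and
   E_C(-,f) are determined by their equations, since eta_X and psi_{-,X} are
   epimorphisms. *)
Record ext_functor (obj : Type) (C : preadditive obj) := ExtFunctor {
  inj_hull : obj -> obj;
  inj_hull_injective : forall X, is_injective C (inj_hull X);
  eta : forall X, mor C X (inj_hull X);
  eta_bimorphism : forall X, bimorphism (eta X);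
  inj_map : forall X Y, mor C X Y -> mor C (inj_hull X) (inj_hull Y);
  inj_mapE : forall X Y (f : mor C X Y), inj_map f \oc eta X = eta Y \oc f;
  ext_obj : obj -> mod_obj C;
  psi : forall X, mor (mod_cat C) (mod_yo C (inj_hull X)) (ext_obj X);
  psi_cokernel : forall X, is_cokernel (mod_yo_map (eta X)) (psi X);
  ext_map : forall X Y, mor C X Y -> mor (mod_cat C) (ext_obj X) (ext_obj Y);
  ext_mapE : forall X Y (f : mor C X Y),
    ext_map f \oc psi X = psi Y \oc mod_yo_map (inj_map f) }.

Arguments ext_map {obj C} E {X Y} f : rename.

(* Main.v *)
Require Import Defs.
From mathcomp Require Import all_boot all_algebra.

(** The sequence is the one attached to a chain of subobjects
    [X <= Y <= X_I], namely
      0 -> X -> Y -> X_I / X -> X_I / Y -> 0.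
    Since [X_I] is injective and [f] is mono, [eta_X] extends along [f] to a
    morphism [g : Y -> X_I]; since [f] and [eta_X] are epi as well, [g] behaves
    as a second injective hull of [Y], so that [f_I : X_I -> Y_I] is an
    isomorphism carrying [g] to [eta_Y] ([bimorphism_inj_map]). Hence
    [E_C(-,Y)] is also the cokernel of [C(-,g)], and the connecting morphism is
    [psi_X] composed with [C(-,g)].

    What remains is valid for every composite [g \oc f] of monomorphisms in an
    abelian category: [f] is a kernel of [Y -> coker (g \oc f)]
    ([kernel_of_factor]) and [coker (g \oc f) -> coker g] is a cokernel of it
    ([cokernel_of_factor]). In the present notion of exactness, where the image
    is the kernel of the cokernel, these two facts give exactness in the middle
    ([kernel_exact], [cokernel_exact]), and the two ends only say that
    [C(-,f)] is mono and that [E_C(-,f)] is epi. *)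

Set Implicit Arguments.
Unset Strict Implicit.
Unset Printing Implicit Defensive.

Import GRing.Theory.
Import Defs.
Local Open Scope ring_scope.

(** * Monomorphisms, epimorphisms and exactness in preadditive categories *)

Section Preadditive.
Context {obj : Type} {C : preadditive obj}.

Lemma compm0 X Y Z (g : mor C Y Z) : g \oc (0 : mor C X Y) = 0.
Proof. by apply: (addrI (g \oc 0)); rewrite -compDr !addr0. Qed.

Lemma comp0m X Y Z (f : mor C X Y) : (0 : mor C Y Z) \oc f = 0.
Proof. by apply: (addrI (0 \oc f)); rewrite -compDl !addr0. Qed.

Lemma mono_eq0 X Y (f : mor C X Y) T (u : mor C T X) :
  is_mono f -> f \oc u = 0 -> u = 0.
Proof. by move=> fm fu0; apply: fm; rewrite fu0 compm0. Qed.

Lemma epi_eq0 X Y (f : mor C X Y) T (u : mor C Y T) :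
  is_epi f -> u \oc f = 0 -> u = 0.
Proof. by move=> fe uf0; apply: fe; rewrite uf0 comp0m. Qed.

Lemma mono_factor X Y Z (g : mor C Y Z) (f : mor C X Y) :
  is_mono (g \oc f) -> is_mono f.
Proof. by move=> gfm T u v fuv; apply: gfm; rewrite -!compA fuv. Qed.

Lemma epi_comp X Y Z (g : mor C Y Z) (f : mor C X Y) :
  is_epi g -> is_epi f -> is_epi (g \oc f).
Proof. by move=> ge fe T u v; rewrite !compA => /fe /ge. Qed.

Lemma epi_factor X Y Z (g : mor C Y Z) (f : mor C X Y) :
  is_epi (g \oc f) -> is_epi g.
Proof. by move=> gfe T u v guv; apply: gfe; rewrite !compA guv. Qed.

Lemma split_epi X Y (f : mor C X Y) (s : mor C Y X) :
  f \oc s = idm Y -> is_epi f.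
Proof.
by move=> fs T u v ufv; rewrite -(compm1 u) -(compm1 v) -fs !compA ufv.
Qed.

Lemma cokernel_epi X Y (f : mor C X Y) Q (q : mor C Y Q) :
  is_cokernel f q -> is_epi q.
Proof.
move=> [qf0 qU] T u v uqv.
have [w [_ wU]] : exists! w, w \oc q = v \oc q.
  by apply: qU; rewrite -compA qf0 compm0.
by rewrite -(wU u uqv) -(wU v erefl).
Qed.

Lemma mono_kernel X Y (f : mor C X Y) Z (g : mor C Y Z) :
  is_mono f -> g \oc f = 0 ->
  (forall T (t : mor C T Y), g \oc t = 0 -> exists u, f \oc u = t) ->
  is_kernel g f.
Proof.
move=> fm gf0 ft; split=> // T t /ft [u fu].
by exists u; split=> // v fv; apply: fm; rewrite fu.
Qed.

Lemma epi_cokernel X Y (f : mor C X Y) Z (g : mor C Y Z) :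
  is_epi g -> g \oc f = 0 ->
  (forall T (t : mor C Y T), t \oc f = 0 -> exists u, u \oc g = t) ->
  is_cokernel f g.
Proof.
move=> ge gf0 tg; split=> // T t /tg [u ug].
by exists u; split=> // v vg; apply: ge; rewrite ug.
Qed.

Lemma kernel_mono X Y (f : mor C X Y) Z (g : mor C Y Z) :
  is_kernel g f -> is_mono f.
Proof.
move=> [gf0 fU] T u v fuv.
have [w [_ wU]] : exists! w, f \oc w = f \oc v.
  by apply: fU; rewrite compA gf0 comp0m.
by rewrite -(wU u fuv) -(wU v erefl).
Qed.

(** Whatever [f] is a kernel of factors through the cokernel of [f], so nothing
    new is annihilated by that cokernel. *)
Lemma kernel_of_cokernel X Y (f : mor C X Y) Z (g : mor C Y Z)
    Q (q : mor C Y Q) :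
  is_kernel g f -> is_cokernel f q -> is_kernel q f.
Proof.
move=> gk [qf0 qU]; have fm := kernel_mono gk; case: gk => gf0 fU.
have [w [wq _]] := qU _ g gf0.
apply: mono_kernel => // T t qt0.
have [|u [fu _]] := fU _ t; last by exists u.
by rewrite -wq -compA qt0 compm0.
Qed.

Lemma kernel_exact X Y (f : mor C X Y) Z (g : mor C Y Z) :
  is_kernel g f -> (exists Q (q : mor C Y Q), is_cokernel f q) -> exact f g.
Proof.
move=> gk [Q [q qc]]; exists Q, q, X, f; split=> //.
exact: kernel_of_cokernel gk qc.
Qed.

Lemma cokernel_exact X Y (f : mor C X Y) Z (g : mor C Y Z) :
  is_cokernel f g -> (exists K (k : mor C K Y), is_kernel g k) -> exact f g.
Proof. by move=> gc [K [k kk]]; exists Z, g, K, k. Qed.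

Lemma to_zero_eq Z X (u v : mor C X Z) : is_zero_obj C Z -> u = v.
Proof. by case=> _ /(_ X) [w [_ wU]]; rewrite -(wU u I) -(wU v I). Qed.

Lemma from_zero_eq Z X (u v : mor C Z X) : is_zero_obj C Z -> u = v.
Proof. by case=> /(_ X) [w [_ wU]] _; rewrite -(wU u I) -(wU v I). Qed.

Lemma mono_exact0l X Y (f : mor C X Y) :
  (exists Z, is_zero_obj C Z) -> is_mono f -> exact0l f.
Proof.
move=> [Z Z0] fm; exists Z; split=> //; apply: kernel_exact.
  apply: mono_kernel => [T u v _||T t /(mono_eq0 fm) ->].
  - exact: to_zero_eq.
  - exact: compm0.
  - by exists 0; rewrite comp0m.
exists X, (idm X); apply: epi_cokernel => [T u v||T t _].
- by rewrite !compm1.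
- by rewrite compm0.
- by exists t; rewrite compm1.
Qed.

Lemma epi_exact0r X Y (f : mor C X Y) :
  (exists Z, is_zero_obj C Z) -> is_epi f -> exact0r f.
Proof.
move=> [Z Z0] fe; exists Z; split=> //; apply: cokernel_exact.
  apply: epi_cokernel => [T u v _||T t /(epi_eq0 fe) ->].
  - exact: from_zero_eq.
  - exact: comp0m.
  - by exists 0; rewrite compm0.
exists Y, (idm Y); apply: mono_kernel => [T u v||T t _].
- by rewrite !comp1m.
- by rewrite comp0m.
- by exists t; rewrite comp1m.
Qed.

(** This is [Y / X <= I / X]: an element of [Y] vanishes in the quotient by [X]
    only if it comes from [X]. *)
Lemma kernel_of_factor X Y I Q (f : mor C X Y) (g : mor C Y I)
    (q : mor C I Q) :
  is_mono g -> is_kernel q (g \oc f) -> is_kernel (q \oc g) f.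
Proof.
move=> gm gfk; have fm := mono_factor (kernel_mono gfk).
case: gfk => qgf0 gfU; apply: mono_kernel => // [|T t]; rewrite -compA //.
by move=> /gfU [u [gfu _]]; exists u; apply: gm; rewrite compA.
Qed.

(** This is [(I / X) / (Y / X) = I / Y], with [I / Y] presented as the cokernel
    of [r \oc g] for an isomorphism [r]. *)
Lemma cokernel_of_factor X Y I J Q R (a : mor C X I) (g : mor C Y I)
    (q : mor C I Q) (r : mor C I J) (s : mor C J I) (p : mor C J R)
    (e : mor C Q R) :
  is_cokernel a q -> is_cokernel (r \oc g) p ->
  s \oc r = idm I -> r \oc s = idm J -> e \oc q = p \oc r ->
  is_cokernel (q \oc g) e.
Proof.
move=> qc pc sr rs eq_pr; have qe := cokernel_epi qc.
have pe := cokernel_epi pc; case: pc => prg0 pU.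
apply: epi_cokernel => [||T t tqg0].
- apply: (@epi_factor _ _ _ e q); rewrite eq_pr.
  by apply: epi_comp => //; apply: split_epi rs.
- by rewrite compA eq_pr -compA.
(* On [J], the morphism [t \oc q] becomes [t \oc q \oc s], which kills the image
   of [Y] and so descends to [R]. *)
have [|w [wp _]] := pU _ (t \oc q \oc s).
  by rewrite -!compA (compA s) sr comp1m.
by exists w; apply: qe; rewrite -compA eq_pr compA wp -compA sr compm1.
Qed.

End Preadditive.

(** * Abelian categories *)

Section Abelian.
Context {obj : Type} {C : preadditive obj} (abC : is_abelian C).

Lemma abelian_mono_kernel X Y (f : mor C X Y) Q (q : mor C Y Q) :
  is_mono f -> is_cokernel f q -> is_kernel q f.
Proof.
have [_ _ _ monoK _] := abC => /monoK [Z [g gk]].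
exact: kernel_of_cokernel gk.
Qed.

(** The exact sequence [0 -> X -> Y -> I / X -> I / Y -> 0] of a chain
    [X <= Y <= I]; see [cokernel_of_factor] for the role of [r] and [s]. *)
Lemma exact_seq4_of_factor X Y I J Q R (f : mor C X Y) (g : mor C Y I)
    (q : mor C I Q) (r : mor C I J) (s : mor C J I) (p : mor C J R)
    (e : mor C Q R) :
  is_mono (g \oc f) -> is_mono g ->
  is_cokernel (g \oc f) q -> is_cokernel (r \oc g) p ->
  s \oc r = idm I -> r \oc s = idm J -> e \oc q = p \oc r ->
  exact_seq4 f (q \oc g) e.
Proof.
move=> gfm gm qc pc sr rs epr.
have [[Z0 _] hasK hasQ _ _] := abC.
have ec := cokernel_of_factor qc pc sr rs epr.
split.
- by apply: mono_exact0l => //; apply: mono_factor gfm.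
- by apply: kernel_exact => //; apply/kernel_of_factor/abelian_mono_kernel.
- exact: cokernel_exact.
- by apply: epi_exact0r => //; apply: cokernel_epi ec.
Qed.

End Abelian.

(** * Injective hulls and representable functors *)

Section InjectiveHulls.
Context {obj : Type} {C : preadditive obj}.

Lemma mod_yo_mapM X Y Z (g : mor C Y Z) (f : mor C X Y) :
  mod_yo_map (g \oc f) = mod_yo_map g \oc mod_yo_map f.
Proof. by apply: nattrans_ext => T x /=; rewrite compA. Qed.

Lemma mod_yo_map1 X : mod_yo_map (idm X) = idm (mod_yo C X).
Proof. by apply: nattrans_ext => T x /=; rewrite comp1m. Qed.

Lemma mod_yo_map_mono X Y (f : mor C X Y) :
  is_mono f -> is_mono (mod_yo_map f).
Proof.
move=> fm T u v fuv; apply: nattrans_ext => W x; apply: fm.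
by have := congr1 (fun a : nattrans _ _ => a W x) fuv.
Qed.

(** Both [X_I] and [Y_I] are injective objects containing [Y] by a bimorphism.
    The extensions in the two directions are mutually inverse because they
    compose to the identity after the epimorphisms [eta_X] and [eta_Y]. *)
Lemma bimorphism_inj_map (E : ext_functor C) X Y (f : mor C X Y) :
  bimorphism f ->
  exists (g : mor C Y (inj_hull E X)) (h : mor C (inj_hull E Y) (inj_hull E X)),
    [/\ g \oc f = eta E X, inj_map E f \oc g = eta E Y,
        h \oc inj_map E f = idm _ & inj_map E f \oc h = idm _].
Proof.
move=> [fm fe].
have [etaXm etaXe] := eta_bimorphism E X.
have [etaYm etaYe] := eta_bimorphism E Y.
have [g gf] := inj_hull_injective (eta E X) fm.
have fIg : inj_map E f \oc g = eta E Y.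
  by apply: fe; rewrite -compA gf inj_mapE.
have [h hY] := inj_hull_injective g etaYm.
exists g, h; split=> //.
  by apply: etaXe; rewrite -compA inj_mapE compA hY gf comp1m.
by apply: etaYe; rewrite -compA hY fIg comp1m.
Qed.

End InjectiveHulls.

Theorem theorem4p10 (obj : Type) (C : preadditive obj)
  (hC : zero_abelian C) (hI : enough_injectives C) (E : ext_functor C)
  (X Y : obj) (f : mor C X Y) (hf : bimorphism f) :
  exists d : mor (mod_cat C) (mod_yo C Y) (ext_obj E X),
    exact_seq4 (mod_yo_map f) d (ext_map E f).
Proof.
have [_ _ [abC _] _ _] := hC.
have [g [h [gf fIg hfI fIh]]] := bimorphism_inj_map E hf.
have [etaXm _] := eta_bimorphism E X.
have gm : is_mono g.
  by apply: (@mono_factor _ _ _ _ _ (inj_map E f)); rewrite fIg;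
    have [] := eta_bimorphism E Y.
exists (psi E X \oc mod_yo_map g).
apply: (exact_seq4_of_factor abC (r := mod_yo_map (inj_map E f))
          (s := mod_yo_map h) (p := psi E Y)).
- by rewrite -mod_yo_mapM gf; apply: mod_yo_map_mono.
- exact: mod_yo_map_mono.
- by rewrite -mod_yo_mapM gf; apply: psi_cokernel.
- by rewrite -mod_yo_mapM fIg; apply: psi_cokernel.
- by rewrite -mod_yo_mapM hfI mod_yo_map1.
- by rewrite -mod_yo_mapM fIh mod_yo_map1.
- exact: ext_mapE.
Qed.
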